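(* Let $p>2$ be a prime, $2\le n\le p-2$, and let $w$ assign a positive real weight to each element of $[p-1]$. Consider the non-projective summand random walk, i.e. the Markov chain on $[p-1]$ with transition matrix $$Q_{i,j}=\frac{w(j)\,[V_i\otimes V_n:V_j]}{\sum_{l\in[p-1]}w(l)\,[V_i\otimes V_n:V_l]} .$$ (a) If $n$ is odd, then the chain is reducible into two chains, one on the even states and one on the odd states, which are each irreducible and aperiodic. (b) If $n$ is even, then the chain is irreducible and periodic with period $2$.
   Context: $k$ is an algebraically closed field of characteristic $p$, $G=\mathrm{SL}_2(\mathbb{F}_p)$, and $[r]=\{1,\dots,r\}$. For $n\ge1$, $V_n$ is the $n$-dimensional $kG$-module of homogeneous polynomials over $k$ of degree $n-1$ in $X,Y$, where $\begin{pmatrix}a&b\\c&d\end{pmatrix}$ acts by $f(X,Y)\mapsto f(aX+cY,bX+dY)$. The modules $V_1,\dots,V_{p-1}$ are the non-projective simple $kG$-modules up to isomorphism. $[M:V]$ denotes the multiplicity of $V$ as an indecomposable direct summand of $M$ (in a decomposition of $M$ into indecomposables). The non-projective summand random walk starts at a non-projective simple module and at each step moves from $U$ to a non-projective indecomposable summand $V$ of $U\otimes V_n$ with probability proportional to $w(V)$ times the multiplicity of $V$; all the non-projective indecomposable summands of $V_i\otimes V_n$ with $i\in[p-1]$ are among $V_1,\dots,V_{p-1}$ and at least one exists, so the chain stays on these modules, and its states are labelled by their dimensions in $[p-1]$. *)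

(* Defs.v *)
From HB Require Import structures.
From mathcomp Require Import all_boot all_order all_algebra all_fingroup.
From mathcomp Require Import mxrepresentation character.
From mathcomp Require Import boolp classical_sets reals.
From mathcomp Require Import mpoly.

Set Implicit Arguments.
Unset Strict Implicit.
Unset Printing Implicit Defensive.

Import GroupScope Order.TTheory GRing.Theory Num.Theory.
Local Open Scope ring_scope.

Section SL2.
Variable p : nat.

Definition SL2_set : {set {'GL_2['F_p]}} :=
  [set g : {'GL_2['F_p]} | \det (GLval g) == 1]%SET.

Lemma SL2_group_set : group_set SL2_set.
Proof.
apply/group_setP; split=> [|g h]; first by rewrite inE GL_1E det1.
by rewrite !inE GL_ME det_mulmx => /eqP-> /eqP->; rewrite mulr1.
Qed.

Canonical SL2 : {group {'GL_2['F_p]}} := Group SL2_group_set.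

End SL2.

Section BinaryForms.
Variables (p : nat) (k : fieldType).

(* The prime-field embedding of F_p into k; it is a ring morphism only when k
   has characteristic p. *)
Definition Fp_in (x : 'F_p) : k := (x : nat)%:R.

(* With X = 'X_0 and Y = 'X_1, the matrix (a b; c d) maps f(X, Y) to
   f(aX + cY, bX + dY). *)
Definition form_act (A : 'M[k]_2) (f : {mpoly k[2]}) : {mpoly k[2]} :=
  f \mPo [tuple A 0 0 *: 'X_0 + A 1 0 *: 'X_1; A 0 1 *: 'X_0 + A 1 1 *: 'X_1].

(* The exponent of X^i Y^(n-1-i). *)
Definition form_mon (n : nat) (i : 'I_n) : 'X_{1..2} :=
  (U_(0%R) *+ i + U_(1%R) *+ (n.-1 - i))%MM.

Definition form_of n (u : 'cV[k]_n) : {mpoly k[2]} :=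
  \sum_(i < n) u i 0 *: 'X_[form_mon i].

(* Column j holds the coordinates of the image of the j-th monomial, so the
   left action of G on forms is u |-> V_mx n g *m u (see form_of_V_mx). *)
Definition V_mx (n : nat) (g : {'GL_2['F_p]}) : 'M[k]_n :=
  \matrix_(i, j) (form_act (map_mx Fp_in (GLval g)) 'X_[form_mon j])@_(form_mon i).

Lemma form_mon0 n (i : 'I_n) : form_mon i 0%R = i.
Proof. by rewrite /form_mon mnmDE !mulmnE !mnm1E /= mul1n mul0n addn0. Qed.

Lemma form_mon1 n (i : 'I_n) : form_mon i 1%R = (n.-1 - i)%N.
Proof. by rewrite /form_mon mnmDE !mulmnE !mnm1E /= mul1n mul0n add0n. Qed.

Lemma form_mon_inj n : injective (@form_mon n).
Proof. by move=> i j eq_ij; apply: val_inj; rewrite /= -!form_mon0 eq_ij. Qed.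

Lemma mdeg2 (m : 'X_{1..2}) : mdeg m = (m 0%R + m 1%R)%N.
Proof.
by rewrite mdegE big_ord_recl big_ord1; congr (_ + m _)%N; apply: val_inj.
Qed.

Lemma mdeg_form_mon n (i : 'I_n) : mdeg (form_mon i) = n.-1.
Proof.
by rewrite mdeg2 form_mon0 form_mon1 subnKC //; case: n i => [[]|n i] //=; rewrite -ltnS.
Qed.

Lemma form_ofE n (u : 'cV[k]_n) i : (form_of u)@_(form_mon i) = u i 0.
Proof.
rewrite raddf_sum (bigD1 i) //= mcoeffZ mcoeffX eqxx mulr1 big1 ?addr0 //.
by move=> j ne_ji; rewrite mcoeffZ mcoeffX (inj_eq (@form_mon_inj n)) (negPf ne_ji) mulr0.
Qed.

Lemma form_of_inj n : injective (@form_of n).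
Proof.
by move=> u v eq_uv; apply/matrixP=> i j; rewrite ord1 -!form_ofE eq_uv.
Qed.

Lemma form_of_homog n (u : 'cV[k]_n) : form_of u \is n.-1.-homog.
Proof.
by apply: rpred_sum => i _; apply: rpredZ; rewrite dhomogX; apply/eqP/mdeg_form_mon.
Qed.

Lemma homog_form_of n (f : {mpoly k[2]}) : (0 < n)%N -> f \is n.-1.-homog ->
  f = form_of (\col_(i < n) f@_(form_mon i)).
Proof.
move=> n_gt0 homf; apply/mpolyP=> m.
have [deg_m|] := eqVneq (mdeg m) n.-1; last first.
  by move=> deg_m; rewrite !(dhomog_nemf_coeff _ deg_m) ?form_of_homog.
have lt_m0 : (m 0%R < n)%N.
  rewrite -(prednK n_gt0) ltnS -deg_m mdeg2; exact: leq_addr.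
suff -> : m = form_mon (Ordinal lt_m0) by rewrite form_ofE mxE.
apply/mnmP=> i; have /orP[/eqP->|/eqP->] : (i == 0) || (i == 1).
- by case: i => -[|[|]].
- by rewrite form_mon0.
by rewrite form_mon1 /= -deg_m mdeg2 addKn.
Qed.

Lemma form_act_homog n (j : 'I_n) A : form_act A 'X_[form_mon j] \is n.-1.-homog.
Proof.
rewrite /form_act comp_mpolyX big_ord_recl big_ord1.
have -> : lift ord0 ord0 = 1 :> 'I_2 by apply: val_inj.
rewrite (_ : ord0 = 0) //.
have -> : n.-1 = (1 * form_mon j 0%R + 1 * form_mon j 1%R)%N.
  rewrite !mul1n form_mon0 form_mon1 subnKC //.
  by case: n j => [[]|n j] //=; rewrite -ltnS.
have lin (a b : k) : (a *: 'X_0 + b *: 'X_1 : {mpoly k[2]}) \is 1.-homog.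
  by apply: rpredD; apply: rpredZ; rewrite dhomogX; apply/eqP/mdeg1.
by apply: dhomogM; apply: dhomogMn; rewrite (tnth_nth 0) /=; apply: lin.
Qed.

Lemma form_of_V_mx n g (u : 'cV[k]_n) :
  form_of (V_mx n g *m u) = form_act (map_mx Fp_in (GLval g)) (form_of u).
Proof.
case: n u => [|n] u.
  by rewrite /form_of !big_ord0 /form_act comp_mpoly0.
rewrite {2}/form_of /form_act raddf_sum /=.
under eq_bigr => j _.
  rewrite comp_mpolyZ -/(form_act _ _).
  rewrite (homog_form_of (ltn0Sn n) (form_act_homog j _)).
  over.
under eq_bigr do rewrite /form_of scaler_sumr.
rewrite exchange_big /form_of; apply: eq_bigr => i _ /=.
rewrite mxE scaler_suml; apply: eq_bigr => j _.
by rewrite !mxE scalerA mulrC.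
Qed.

Lemma form_act1 f : form_act 1%:M f = f.
Proof.
rewrite /form_act -[RHS]comp_mpoly_id; congr (_ \mPo _).
apply: eq_from_tnth => i; rewrite tnth_mktuple (tnth_nth 0).
by case: i => -[|[|]] // lt_i; rewrite !mxE /= ?scale1r ?scale0r ?addr0 ?add0r;
  congr 'X_ _; apply: val_inj.
Qed.

Lemma form_actM A B f : form_act (A *m B) f = form_act A (form_act B f).
Proof.
rewrite /form_act [f]mpolyE [LHS]raddf_sum [X in _ = X \mPo _]raddf_sum [RHS]raddf_sum.
apply: eq_bigr => m _ /=; rewrite !comp_mpolyZ; congr (_ *: _).
rewrite !comp_mpolyX rmorph_prod /=; apply: eq_bigr => i _.
rewrite rmorphXn /=; congr (_ ^+ _).
have E (C : 'M[k]_2) (j : 'I_2) : tnth [tuple C 0 0 *: 'X_0 + C 1 0 *: 'X_1;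
    C 0 1 *: 'X_0 + C 1 1 *: 'X_1] j = C 0 j *: 'X_0 + C 1 j *: 'X_1 :> {mpoly k[2]}.
  by rewrite (tnth_nth 0); case: j => -[|[|]] // lt_j /=;
    congr (C _ _ *: _ + C _ _ *: _); apply: val_inj.
rewrite !E comp_mpolyD !comp_mpolyZ !comp_mpolyXU /= !mxE !big_ord_recl !big_ord0.
have -> : lift ord0 ord0 = 1 :> 'I_2 by apply: val_inj.
have -> : ord0 = 0 :> 'I_2 by apply: val_inj.
rewrite !addr0 !scalerDl !scalerDr !scalerA.
rewrite ![B _ _ * A _ _]mulrC addrACA; exact.
Qed.

Hypothesis charkp : p \in [pchar k].

Lemma Fp_inD : {morph Fp_in : x y / x + y}.
Proof.
have p_pr := pcharf_prime charkp.
move=> x y; rewrite /Fp_in /= -natrD.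
rewrite -[RHS](GRing.natr_mod_pchar charkp); congr (_ %% _)%N%:R.
exact: Fp_cast.
Qed.

Lemma Fp_inM : {morph Fp_in : x y / x * y}.
Proof.
have p_pr := pcharf_prime charkp.
move=> x y; rewrite /Fp_in /= -natrM.
rewrite -[RHS](GRing.natr_mod_pchar charkp); congr (_ %% _)%N%:R.
exact: Fp_cast.
Qed.

Lemma V_mx_repr n : mx_repr (SL2 p) (V_mx n).
Proof.
split=> [|g h _ _].
  apply/trmx_inj/row_matrixP=> i; rewrite -!tr_col; congr (_^T).
  rewrite [LHS]colE [RHS]colE; apply: form_of_inj.
  rewrite form_of_V_mx mul1mx GL_1E.
  rewrite [map_mx _ _](_ : _ = 1%:M) ?form_act1 //.
  by apply/matrixP=> r s; rewrite !mxE; case: (r == s); rewrite /Fp_in ?mulr0n.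
apply/trmx_inj/row_matrixP=> i; rewrite -!tr_col; congr (_^T).
rewrite [LHS]colE [RHS]colE; apply: form_of_inj.
rewrite -mulmxA !form_of_V_mx -form_actM GL_MxE; congr form_act.
apply/matrixP=> r s; rewrite !mxE !big_ord_recl !big_ord0 !addr0.
by rewrite Fp_inD !Fp_inM !mxE.
Qed.

(* The left module V_n, with V_mx acting on columns.  Isomorphism (mx_rsim),
   direct sums (dadd_grepr) and tensor products (prod_repr, the Kronecker
   product) are conditions on the matrices alone, so they have the same meaning
   for this reading as for the row-vector one used in mxrepresentation. *)
Definition V_repr n : mx_representation k (SL2 p) n := MxRepresentation (V_mx_repr n).

End BinaryForms.

Section Multiplicity.
Variables (k : fieldType) (gT : finGroupType) (G : {group gT}).
Implicit Types M V : representation k G.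

Definition indecomposable M :=
  (0 < rdegree M)%N /\
  forall A B : representation k G,
    mx_rsim M (dadd_grepr A B) -> rdegree A = 0%N \/ rdegree B = 0%N.

Definition indecomposable_decomposition M m (A : 'I_m -> representation k G) :=
  (forall i, indecomposable (A i)) /\
  mx_rsim M (\big[dadd_grepr/grepr0]_(i < m) A i).

(* [M : V] is read off from some decomposition of M into indecomposables; by the
   Krull-Schmidt theorem it does not depend on the one that xget picks. *)
Definition summand_mult M V : nat :=
  xget 0%N [set c | exists m (A : 'I_m -> representation k G),
    indecomposable_decomposition M A /\
    c = #|[pred i | `[< mx_rsim (A i) V >]]| ]%classic.

End Multiplicity.

Section MarkovChains.
Variable R : realType.

Definition stochastic m (Q : 'M[R]_m) :=
  (forall i j, 0 <= Q i j) /\ (forall i, \sum_j Q i j = 1).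

Definition irreducible_chain m (Q : 'M[R]_m) :=
  forall i j, exists t : nat, 0 < (Q ^+ t) i j.

Definition return_time m (Q : 'M[R]_m) (i : 'I_m) (t : nat) :=
  (0 < t)%N /\ 0 < (Q ^+ t) i i.

(* d is the gcd of the set of return times of i (0 if that set is empty). *)
Definition state_period m (Q : 'M[R]_m) (i : 'I_m) (d : nat) :=
  forall e : nat, (e %| d)%N <-> (forall t, return_time Q i t -> (e %| t)%N).

Definition has_period m (Q : 'M[R]_m) (d : nat) := forall i, state_period Q i d.

Definition aperiodic m (Q : 'M[R]_m) := has_period Q 1.

Definition subchain m (Q : 'M[R]_m) (S : {set 'I_m}) : 'M[R]_#|S| :=
  mxsub enum_val enum_val Q.

(* S1 and S2 partition the states and no transition leads from one to the
   other. *)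
Definition reducible_into m (Q : 'M[R]_m) (S1 S2 : {set 'I_m}) :=
  [/\ S1 != finset.set0 /\ S2 != finset.set0,
      [disjoint S1 & S2] /\ S1 :|: S2 = [set: 'I_m],
      (forall i j, i \in S1 -> j \in S2 -> Q i j = 0) &
      (forall i j, i \in S2 -> j \in S1 -> Q i j = 0)]%SET.

End MarkovChains.

(* The state [p-1] = {1, ..., p-1} is encoded as 'I_(p.-1), the ordinal i
   standing for the state i.+1, i.e. for the module of dimension i.+1. *)
Section Walk.
Variables (p : nat) (k : fieldType) (charkp : p \in [pchar k]).
Variables (R : realType) (n : nat) (w : 'I_p.-1 -> R).

Definition even_states : {set 'I_p.-1} := [set i : 'I_p.-1 | ~~ odd i.+1]%SET.
Definition odd_states : {set 'I_p.-1} := [set i : 'I_p.-1 | odd i.+1]%SET.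

Definition walk_mult (i j : 'I_p.-1) : nat :=
  summand_mult (Representation (prod_repr (V_repr charkp i.+1) (V_repr charkp n)))
               (Representation (V_repr charkp j.+1)).

Definition walk_mx : 'M[R]_p.-1 :=
  \matrix_(i, j) (w j * (walk_mult i j)%:R / \sum_l w l * (walk_mult i l)%:R).

End Walk.

(* Main.v *)
From HB Require Import structures.
Require Import Defs.
From mathcomp Require Import all_boot all_order all_algebra all_fingroup.
From mathcomp Require Import mxrepresentation character.
From mathcomp Require Import boolp classical_sets reals mpoly.
From mathcomp Require Import ring zify.

(** The theorem follows from two facts about the summands of the tensor product
    of V_i and V_n, where the states i and j are dimensions in 1, ..., p-1.

    Parity.  The central matrix -1 acts on V_m as the scalar (-1)^(m-1), so it
    acts as (-1)^(i+n) on each summand of the tensor product.  A step of the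
    walk therefore changes the parity of the state exactly when n is even
    ([walk_mult_odd]).

    Existence.  If i = x+y+1, n = x+z+1 and j = y+z+1 with x+y+z+1 < p, then V_j
    is a summand ([walk_mult_gt0]).  Write [u,v] for the determinant of two
    vectors of the plane.  The function [u,v]^x [u,w]^y [v,w]^z is invariant
    under SL_2 and homogeneous of degrees i-1, n-1, j-1 in u, v, w, so its
    coefficients form an invariant tensor; the invariant bilinear forms with
    values [u,v]^(m-1), which are nondegenerate for m <= p, turn this tensor into
    homomorphisms from V_j to the tensor product and back.  Their composite is
    nonzero: combined with the form of V_j, it takes at a pair of points the value
    [theta] up to sign, which a Vandermonde-type convolution identifies with
    C(x+y+z+1, x) divided by the product of C(x+y, x) and C(x+z, x)
    ([theta_neq0]).  All endomorphisms of V_j are scalars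
    ([scalar_endomorphism]).  Given any decomposition of the tensor product into
    indecomposables, the composite is nonzero through one of the terms, hence the
    identity of V_j factors through that term, which must then be V_j
    ([summand_mult_gt0]).

    The condition on (x, y, z) is symmetric in x and z, so the steps obtained in
    this way can be reversed.  Two states that differ by 2 have a common
    neighbour, which makes each parity class communicate.  For n even, the
    parity changes at each step, every state has a neighbour, and a step forth
    and back takes time 2.  For n odd, the choice x = z = (n-1)/2 gives loops in
    both parity classes, because n <= p-2 leaves room for two consecutive values
    of y; so both classes are aperiodic. *)

Set Implicit Arguments.
Unset Strict Implicit.
Unset Printing Implicit Defensive.

Import Order.TTheory GRing.Theory Num.Theory.
Local Open Scope ring_scope.

(** * Summands of representations *)

Section Decomposition.
Variables (F : fieldType) (gT : finGroupType) (G : {group gT}).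
Implicit Types M V W : representation F G.

Definition intertwines M V (f : 'M[F]_(rdegree M, rdegree V)) :=
  forall g, g \in G -> M g *m f = f *m V g.

Lemma intertwines_mul M V W f h : @intertwines M V f -> @intertwines V W h ->
  @intertwines M W (f *m h).
Proof. by move=> Cf Ch g Gg; rewrite mulmxA Cf // -!mulmxA Ch. Qed.

Definition retract M V := exists i p,
  [/\ @intertwines V M i, @intertwines M V p & i *m p = 1%:M].

Lemma retract_trans M V W : retract M V -> retract V W -> retract M W.
Proof.
move=> [i [p [Ci Cp ip]]] [j [q [Cj Cq jq]]].
exists (j *m i), (p *m q); split; try exact: intertwines_mul.
by rewrite mulmxA -(mulmxA j) ip mulmx1.
Qed.

Lemma rsim_maps M V : mx_rsim M V -> exists f h,
  [/\ @intertwines M V f, @intertwines V M h, f *m h = 1%:M & h *m f = 1%:M].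
Proof.
case/mx_rsim_def=> f [h hf defM].
have fh : f *m h = 1%:M by rewrite -(repr_mx1 M) defM // repr_mx1 mulmx1.
exists f, h; split=> // g Gg; rewrite defM // -?mulmxA ?hf ?mulmx1 //.
by rewrite !mulmxA hf mul1mx.
Qed.

Lemma dadd_retract_l V W : retract (dadd_grepr V W) V.
Proof.
exists (row_mx 1%:M 0), (col_mx 1%:M 0); split=> [g Gg|g Gg|] /=.
- by rewrite mul_mx_row mul_row_block !(mulmx0, mul0mx, mulmx1, mul1mx, addr0).
- by rewrite [RHS]mul_col_mx mul_block_col !(mulmx0, mul0mx, mulmx1, mul1mx, addr0).
by rewrite mul_row_col mulmx0 mulmx1 addr0.
Qed.

Lemma rsim_retract M V : mx_rsim M V -> retract M V.
Proof. by case/rsim_maps=> f [h [Cf Ch fh hf]]; exists h, f. Qed.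

(** The image of the section [i] and the kernel of the retraction [p] are
    complementary submodules. *)
Lemma retract_summand M V : retract M V -> exists W, mx_rsim M (dadd_grepr V W).
Proof.
move=> [i [p [Ci Cp ip]]].
have modU : mxmodule M <<i>>%MS.
  apply/mxmoduleP=> g Gg; rewrite (eqmxMr _ (genmxE i)) genmxE -Ci //.
  exact: submxMl.
have modW : mxmodule M (kermx p).
  apply/mxmoduleP=> g Gg; apply/sub_kermxP.
  by rewrite -mulmxA Cp // mulmxA mulmx_ker mul0mx.
exists (Representation (submod_repr modW)).
have addUW : (<<i>> + kermx p :=: 1%:M)%MS.
  apply/eqmxP; rewrite submx1 /=.
  rewrite -[1%:M](subrK (p *m i)) addrC addmx_sub_adds //.
    by rewrite genmxE submxMl.
  by apply/sub_kermxP; rewrite mulmxBl mul1mx -mulmxA ip mulmx1 subrr.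
have dxUW : mxdirect (<<i>> + kermx p).
  apply/mxdirect_addsP/eqP; rewrite -submx0; apply/rV_subP=> v.
  rewrite sub_capmx genmxE => /andP[/submxP[w ->] /sub_kermxP].
  by rewrite -mulmxA ip mulmx1 => ->; rewrite mul0mx sub0mx.
apply: mx_rsim_trans (mx_rsim_sym (rsim_submod1 (mxmodule1 M) (eqmx_refl _))) _.
apply: (@mx_rsim_dadd _ _ _ _ M _ _ _ V (Representation (submod_repr modW))
  modU modW (mxmodule1 M) addUW dxUW); last exact: mx_rsim_refl.
have i_free : row_free i by apply/row_freeP; exists p.
exists (val_submod 1%:M *m p) => [||g Gg].
- by rewrite genmxE (eqP i_free).
- apply/row_freeP; exists (i *m in_submod <<i>>%MS 1%:M).
  have := val_submodP (1%:M : 'M_(\rank <<i>>%MS)).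
  rewrite genmxE => /submxP[D defU].
  transitivity (val_submod (1%:M : 'M_(\rank <<i>>%MS)) *m in_submod <<i>>%MS 1%:M).
    rewrite !mulmxA; congr (_ *m _).
    by rewrite defU -!mulmxA [i *m (p *m _)]mulmxA ip mul1mx.
  by rewrite -in_submodE val_submodK.
rewrite mulmxA -val_submodE -[submod_repr _ g]mul1mx val_submodJ //.
by rewrite -!mulmxA Cp.
Qed.

Lemma rsim_dadd_grepr0 M V W : rdegree W = 0%N -> mx_rsim M (dadd_grepr V W) -> mx_rsim M V.
Proof.
case: W => d W /= d0; subst d => /mx_rsim_trans; apply.
exists (col_mx 1%:M 0) => [||g Gg] /=; first by rewrite addn0.
  apply/row_freeP; exists (row_mx 1%:M 0).
  rewrite mul_col_mx mul1mx mul0mx [RHS]scalar_mx_block /block_mx.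
  by congr col_mx; apply/matrixP=> -[].
by rewrite [RHS]mul_col_mx mul_block_col !(mulmx0, mul0mx, mulmx1, mul1mx, addr0).
Qed.

Lemma retract_indecomposable M V : indecomposable M -> (0 < rdegree V)%N ->
  retract M V -> mx_rsim M V.
Proof.
move=> [_ indM] V_gt0 /retract_summand[W simM].
by apply: (rsim_dadd_grepr0 _ simM); case: (indM _ _ simM) => // V0; rewrite V0 in V_gt0.
Qed.

Lemma dadd_rsim_r V W W' : mx_rsim W W' -> mx_rsim (dadd_grepr V W) (dadd_grepr V W').
Proof.
case=> B eqd B_free homB; exists (block_mx 1%:M 0 0 B) => [||g Gg] /=.
- by rewrite eqd.
- have /row_freeP[C BC] := B_free; apply/row_freeP; exists (block_mx 1%:M 0 0 C).
  rewrite mulmx_block !(mulmx0, mul0mx, mulmx1, mul1mx, addr0, add0r) BC.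
  by rewrite -scalar_mx_block.
by rewrite !mulmx_block !(mulmx0, mul0mx, mulmx1, mul1mx, addr0, add0r) homB.
Qed.

(** Passing through retracts instead of summands makes the descent to a smaller
    summand a composition of maps, with no reassociation of direct sums. *)
Lemma ex_indecomposable_retract M : (0 < rdegree M)%N ->
  exists2 V, indecomposable V & retract M V.
Proof.
have [m le_m] := ubnP (rdegree M); elim: m => // m IH in M le_m *.
move=> M_gt0; have [indM|not_indM] := pselect (indecomposable M).
  by exists M => //; apply: rsim_retract; apply: mx_rsim_refl.
have [A [B [simM A_neq0 B_neq0]]] : exists A B : representation F G,
    [/\ mx_rsim M (dadd_grepr A B), rdegree A <> 0%N & rdegree B <> 0%N].
  apply: contrapT => no; apply: not_indM; split=> // A B simM.
  apply: contrapT => /not_orP[A0 B0]; apply: no; by exists A, B.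
have degM : rdegree M = (rdegree A + rdegree B)%N := mxrank_rsim simM.
have [||V indV AV] := IH A; [lia..|].
exists V => //; apply: retract_trans AV.
by apply: retract_trans (rsim_retract simM) (dadd_retract_l A B).
Qed.

Lemma ex_decomposition M : exists m (A : 'I_m -> representation F G),
  indecomposable_decomposition M A.
Proof.
have [m le_m] := ubnP (rdegree M); elim: m => // m IH in M le_m *.
have [M0|M_gt0] := posnP (rdegree M).
  exists 0%N, (fun=> grepr0); split=> [[]|] //; rewrite big_ord0.
  exists 0 => // [|g _]; last by rewrite mul0mx mulmx0.
  by rewrite /row_free mxrank0 M0.
have [V indV /retract_summand[W simM]] := ex_indecomposable_retract M_gt0.
have degM : rdegree M = (rdegree V + rdegree W)%N := mxrank_rsim simM.
have [|r [A [indA simW]]] := IH W; first by have [] := indV; lia.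
exists r.+1, (fun i => if unlift ord0 i is Some j then A j else V); split=> [i|].
  by case: unliftP => [j|] _; [apply: indA | apply: indV].
rewrite big_ord_recl unlift_none.
under eq_bigr do rewrite liftK.
exact: mx_rsim_trans simM (dadd_rsim_r V simW).
Qed.

(** The composite is the sum of the composites through the individual terms, so
    they cannot all vanish. *)
Lemma big_dadd_factor m (A : 'I_m -> representation F G) V W
    (S := \big[dadd_grepr/grepr0]_(i < m) A i) f h :
    @intertwines V S f -> @intertwines S W h -> f *m h != 0 ->
  exists i f' h', [/\ @intertwines V (A i) f', @intertwines (A i) W h' & f' *m h' != 0].
Proof.
elim: m => [|m IH] in A S f h *.
  rewrite {}/S in f h *; move: f h; rewrite big_ord0 => f h _ _ /eqP[].
  by rewrite [f]thinmx0 mul0mx.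
rewrite {}/S in f h *; move: f h; rewrite big_ord_recl.
set B := \big[_/_]_(i < m) _ => f h.
rewrite -[f](@hsubmxK F _ (rdegree (A ord0)) (rdegree B)).
rewrite -[h](@vsubmxK F (rdegree (A ord0)) (rdegree B)).
move: (lsubmx f) (rsubmx f) (usubmx h) (dsubmx h) => f1 f2 h1 h2 Cf Ch.
have Cf' g : g \in G -> V g *m f1 = f1 *m A ord0 g /\ V g *m f2 = f2 *m B g.
  move=> Gg; have := Cf g Gg; rewrite mul_mx_row [RHS]mul_row_block.
  by rewrite !(mulmx0, addr0, add0r) => /eq_row_mx.
have Ch' g : g \in G -> A ord0 g *m h1 = h1 *m W g /\ B g *m h2 = h2 *m W g.
  move=> Gg; have := Ch g Gg; rewrite [RHS]mul_col_mx [LHS]mul_block_col.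
  by rewrite !(mul0mx, addr0, add0r) => /eq_col_mx.
rewrite [_ *m _](@mul_row_col F).
have [-> |nz1 _] := eqVneq (f1 *m h1) 0; last first.
  by exists ord0, f1, h1; split=> // g Gg; [case: (Cf' g Gg)|case: (Ch' g Gg)].
rewrite add0r => nz2.
have [||i [f' [h' [Cfi Chi nz]]]] := IH (fun i => A (lift ord0 i)) f2 h2 _ _ nz2.
- by move=> g Gg; case: (Cf' g Gg).
- by move=> g Gg; case: (Ch' g Gg).
by exists (lift ord0 i), f', h'.
Qed.

Lemma big_dadd_scalar m (A : 'I_m -> representation F G) g c :
    (\big[dadd_grepr/grepr0]_(i < m) A i) g = c%:M ->
  forall i, A i g = c%:M.
Proof.
elim: m => [|m IH] in A *; first by move=> _ [].
rewrite big_ord_recl /= [c%:M]scalar_mx_block => /eq_block_mx[A0 _ _ AS] i.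
case: (unliftP ord0 i) => [j ->|-> //].
exact: (IH (fun j => A (lift ord0 j))).
Qed.

Lemma summand_multP M V : exists m (A : 'I_m -> representation F G),
  indecomposable_decomposition M A /\
  summand_mult M V = #|[pred i | `[< mx_rsim (A i) V >]]|.
Proof.
rewrite /summand_mult; set P := [set c | _]%classic.
have [m [A decA]] := ex_decomposition M.
by apply: (@xgetPex _ 0%N P); exists #|[pred i | `[< mx_rsim (A i) V >]]|, m, A.
Qed.

(** Through one term of the decomposition the composite is a nonzero scalar, so V
    is a retract of that indecomposable term. *)
Lemma summand_mult_gt0 M V f h : (0 < rdegree V)%N ->
    (forall u, @intertwines V V u -> exists c, u = c%:M) ->
    @intertwines V M f -> @intertwines M V h -> f *m h != 0 ->
  (0 < summand_mult M V)%N.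
Proof.
move=> V_gt0 endV Cf Ch fh_neq0; have [m [A [[indA simM] ->]]] := summand_multP M V.
have [u [v [Cu Cv uv _]]] := rsim_maps simM.
have [||| i [f' [h' [Cf' Ch' nz]]]] := @big_dadd_factor _ A V V (f *m u) (v *m h).
- exact: intertwines_mul Cf Cu.
- exact: intertwines_mul Cv Ch.
- by rewrite mulmxA -(mulmxA f) uv mulmx1.
have [c def_c] := endV _ (intertwines_mul Cf' Ch').
have c_neq0 : c != 0 by apply: contraNneq nz => c0; rewrite def_c c0 raddf0.
apply/card_gt0P; exists i; rewrite inE; apply/asboolP; apply: asboolT.
apply: (@retract_indecomposable (A i) V (indA i) V_gt0); exists f', (c^-1 *: h'); split=> //.
  by move=> g Gg; rewrite -scalemxAr Ch' // scalemxAl.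
by rewrite -scalemxAr def_c scale_scalar_mx mulVf.
Qed.

(** Applied to a central group element, this separates modules by their central
    character. *)
Lemma summand_mult_scalar M V g c d : g \in G -> (0 < rdegree V)%N ->
  (0 < summand_mult M V)%N -> M g = c%:M -> V g = d%:M -> c = d.
Proof.
move=> Gg V_gt0; have [m [A [[indA simM] ->]]] := summand_multP M V.
case/card_gt0P=> i; rewrite inE => /asboolP/asboolP simV Mg Vg.
have Ag := big_dadd_scalar (mx_rsim_scalar Gg simM Mg) i.
have := mx_rsim_scalar Gg simV Ag; rewrite Vg => /matrixP/(_ (Ordinal V_gt0) (Ordinal V_gt0)).
by rewrite !mxE eqxx.
Qed.

End Decomposition.

(** * The plane and its determinant *)

Section Plane.
Variable k : comNzRingType.

Definition pt (a b : k) : 'rV[k]_2 := \row_i (if i == 0 then a else b).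

Definition mx22 (a b c d : k) : 'M[k]_2 := col_mx (pt a b) (pt c d).

Definition wedge (v w : 'rV[k]_2) : k := v 0 0 * w 0 1 - v 0 1 * w 0 0.

Lemma ord2E : (lift ord0 ord0 = 1 :> 'I_2) * (ord0 = 0 :> 'I_2).
Proof. by split; apply: val_inj. Qed.

Lemma ptE a b : (pt a b 0 0 = a) * (pt a b 0 1 = b).
Proof. by rewrite !mxE. Qed.

Lemma mx22E a b c d : (mx22 a b c d 0 0 = a) * (mx22 a b c d 0 1 = b) *
  (mx22 a b c d 1 0 = c) * (mx22 a b c d 1 1 = d).
Proof.
rewrite /mx22 /col_mx; do !split; rewrite mxE; case: splitP => -[[|?] ?] //= _; by rewrite mxE.
Qed.

Lemma mul_pt_mx22 (v : 'rV[k]_2) (A : 'M[k]_2) :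
  v *m A = pt (v 0 0 * A 0 0 + v 0 1 * A 1 0) (v 0 0 * A 0 1 + v 0 1 * A 1 1).
Proof.
apply/rowP=> i; rewrite !mxE !big_ord_recl big_ord0 addr0 !ord2E.
by case: i => -[|[|]] // lt_i /=; congr (_ * A _ _ + _ * A _ _); apply: val_inj.
Qed.

Lemma det_mx2 (A : 'M[k]_2) : \det A = A 0 0 * A 1 1 - A 0 1 * A 1 0.
Proof.
rewrite (expand_det_row _ 0) !big_ord_recl big_ord0 addr0 !ord2E.
rewrite /cofactor !det_mx11 !mxE /= expr0 expr1 mul1r mulN1r mulrN.
by congr (_ * A _ _ - _ * A _ _); apply: val_inj.
Qed.

Lemma wedge_mul v w A : wedge (v *m A) (w *m A) = wedge v w * \det A.
Proof. by rewrite det_mx2 !mul_pt_mx22 /wedge !ptE; ring. Qed.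

End Plane.

Section Group.
Variables (p : nat) (k : fieldType).
Hypothesis charkp : p \in [pchar k].

Lemma Fp_in_nat n : Fp_in k (n%:R : 'F_p) = n%:R.
Proof.
have p_pr := pcharf_prime charkp.
by rewrite /Fp_in val_Fp_nat // GRing.natr_mod_pchar.
Qed.

Lemma Fp_inN (x : 'F_p) : Fp_in k (- x) = - Fp_in k x.
Proof.
by apply/eqP; rewrite -addr_eq0 -(Fp_inD charkp) addNr.
Qed.

Lemma SL2_lift (A : 'M['F_p]_2) : \det A = 1 -> exists2 g, g \in SL2 p & GLval g = A.
Proof.
move=> detA; have uA : A \in unitmx by rewrite unitmxE detA unitr1.
exists (Sub (A : 'M_(2.-1.+1)) uA : {'GL_2['F_p]}); last by rewrite SubK.
by rewrite inE SubK detA.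
Qed.

Lemma SL2_pt_lift (a b c d : 'F_p) : a * d - b * c = 1 ->
  exists2 g, g \in SL2 p &
    forall v : 'rV[k]_2, v *m map_mx (@Fp_in p k) (GLval g) =
      pt (v 0 0 * Fp_in k a + v 0 1 * Fp_in k c) (v 0 0 * Fp_in k b + v 0 1 * Fp_in k d).
Proof.
move=> det1; have [|g Gg defg] := @SL2_lift (mx22 a b c d).
  by rewrite det_mx2 !mx22E.
by exists g => // v; rewrite mul_pt_mx22 !mxE; move: defg => ->; rewrite !mx22E.
Qed.

Lemma det_SL2_map g : g \in SL2 p -> \det (map_mx (@Fp_in p k) (GLval g)) = 1.
Proof.
rewrite inE => /eqP detg; rewrite det_mx2 !mxE -!(Fp_inM charkp) -Fp_inN -(Fp_inD charkp).
by rewrite -det_mx2 detg (Fp_in_nat 1).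
Qed.

End Group.

(** * Bilinearity and transposition of Kronecker products *)

Section TensorProduct.
Variable F : fieldType.

Lemma tprod_linear_r m1 n1 (A : 'M[F]_(m1, n1)) m2 n2 : linear (@tprod F _ _ A m2 n2).
Proof.
elim: m1 A => [|m1 IH] A c B B' /=; first by apply/matrixP=> -[].
by rewrite linearP IH -add_col_mx -scale_col_mx.
Qed.

(** The Kronecker product as a function of its left factor, so that linearity in
    that factor can be registered too. *)
Definition tprodr m1 n1 m2 n2 (B : 'M[F]_(m2, n2)) (A : 'M[F]_(m1, n1)) := tprod A B.

Lemma tprod_linear_l m1 n1 m2 n2 (B : 'M[F]_(m2, n2)) : linear (@tprodr m1 n1 _ _ B).
Proof.
rewrite /tprodr; elim: m1 => [|m1 IH] c A A' /=; first by apply/matrixP=> -[].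
by rewrite linearP -trowbE linearP /= linearP IH -add_col_mx -scale_col_mx.
Qed.

HB.instance Definition _ m1 n1 (A : 'M[F]_(m1, n1)) m2 n2 :=
  GRing.isLinear.Build F _ _ _ (@tprod F _ _ A m2 n2) (@tprod_linear_r m1 n1 A m2 n2).
HB.instance Definition _ m1 n1 m2 n2 (B : 'M[F]_(m2, n2)) :=
  GRing.isLinear.Build F _ _ _ (@tprodr m1 n1 _ _ B) (@tprod_linear_l m1 n1 m2 n2 B).

Lemma mulmx_sum_col_row m n q (A : 'M[F]_(m, n)) (B : 'M[F]_(n, q)) :
  A *m B = \sum_t col t A *m row t B.
Proof.
apply/matrixP=> i j; rewrite mxE summxE; apply: eq_bigr => t _.
by rewrite mxE big_ord1 !mxE.
Qed.

Lemma tprod11 (a b : 'M[F]_1) : tprod a b 0 0 = a 0 0 * b 0 0.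
Proof. by have := mxtrace_prod a b; rewrite /mxtrace !big_ord1. Qed.

(** [tprod] is defined by recursion on the rows of its left factor; this is the
    matching recursion on columns, which [trmx_tprod] needs. *)
Lemma tprod_row_mx n1 m1 m2 n2 (a : 'M[F]_(n1, 1)) (D : 'M[F]_(n1, m1)) (C : 'M[F]_(n2, m2)) :
  tprod (row_mx a D : 'M_(n1, 1 + m1)) C = row_mx (trow a^T C^T)^T (tprod D C).
Proof.
elim: n1 a D => [|n1 IH] a D /=; first by apply/matrixP=> -[].
rewrite -[a](@vsubmxK F 1 n1) -[D](@vsubmxK F 1 n1) -(@block_mxEh _ 1 n1 1 m1) /block_mx.
rewrite (@col_mxKu _ 1) (@col_mxKd _ 1) /= (@row_mxKl _ _ 1) (@row_mxKr _ _ 1) IH.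
rewrite (@col_mxKu _ 1) (@col_mxKd _ 1) (@tr_col_mx _ 1) (@row_mxKl _ _ 1) (@row_mxKr _ _ 1).
rewrite tr_row_mx linearZ /= trmxK [(_^T) 0 0]mxE.
exact: block_mxEh.
Qed.

Lemma trmx_tprod m1 n1 m2 n2 (A : 'M[F]_(m1, n1)) (B : 'M[F]_(m2, n2)) :
  (tprod A B)^T = tprod A^T B^T.
Proof.
elim: m1 A => [|m1 IH] A /=; first by apply/matrixP=> i [].
rewrite tr_col_mx IH -[in RHS](@vsubmxK F 1 m1 _ A) (@tr_col_mx _ 1).
by rewrite tprod_row_mx !trmxK.
Qed.

End TensorProduct.

Local Arguments tprod : simpl never.

Lemma tprod_scalar (F : fieldType) a b (c d : F) :
  tprod (c%:M : 'M_a) (d%:M : 'M_b) = (c * d)%:M.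
Proof.
rewrite -[in LHS](scalemx1 a c) -(scalemx1 b d) linearZ /= -[tprod _ _]/(tprodr _ _) linearZ /=.
by rewrite /tprodr tprod1 scalerA mulrC scalemx1.
Qed.

(** * Evaluation of forms at points of the plane *)

Section Veronese.
Variables (p : nat) (k : fieldType).
Hypothesis charkp : p \in [pchar k].

(** The row that evaluates forms of degree n-1 at v.  Right multiplication by
    group elements moves the point v linearly ([veronese_act]), and the rows at
    n distinct points of an affine line form a Vandermonde matrix
    ([sample_unit]).  Identities between equivariant matrices thus reduce to
    identities between functions of points. *)
Definition veronese n (v : 'rV[k]_2) : 'rV[k]_n :=
  \row_(i < n) (v 0 0 ^+ i * v 0 1 ^+ (n.-1 - i)).

Lemma veroneseE n v (u : 'cV[k]_n) :
  (veronese n v *m u) 0 0 = (form_of u).@[fun i => v 0 i].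
Proof.
rewrite mxE raddf_sum /=; apply: eq_bigr => i _.
rewrite mxE mevalZ mevalX big_ord_recl big_ord1 !ord2E form_mon0 form_mon1.
by rewrite mulrC.
Qed.

Lemma veronese_act n v (g : {'GL_2['F_p]}) :
  veronese n v *m V_mx k n g = veronese n (v *m map_mx (@Fp_in p k) (GLval g)).
Proof.
apply/rowP=> j.
have colE (w : 'rV[k]_n) : w 0 j = (w *m delta_mx j 0 : 'M_1) 0 0.
  by rewrite -colE mxE.
rewrite !colE -mulmxA !veroneseE form_of_V_mx /form_act comp_mpoly_meval.
apply: meval_eq => i; rewrite (tnth_nth 0) mul_pt_mx22.
case: i => -[|[|]] // lt_i /=; rewrite mevalD !mevalZ !mevalXU !mxE /=;
  by rewrite ![v 0 _ * _]mulrC.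
Qed.

Lemma nat_inj_pchar i j : (i < p)%N -> (j < p)%N -> (i%:R == j%:R :> k) = (i == j).
Proof.
wlog le_ij : i j / (i <= j)%N => [hw lt_i lt_j|lt_i lt_j].
  case/orP: (leq_total i j) => ?; first exact: hw.
  by rewrite eq_sym hw // eq_sym.
rewrite eq_sym -subr_eq0 -natrB // -(dvdn_pcharf charkp) [RHS]eq_sym.
apply/idP/eqP=> [|->]; last by rewrite subnn dvdn0.
move=> dv; apply/eqP; rewrite eqn_leq le_ij andbT -subn_eq0.
by apply: contraLR dv; rewrite -lt0n => gt0; rewrite gtnNdvd //; lia.
Qed.

Definition sample n : 'M[k]_n := \matrix_(t < n) veronese n (pt t%:R 1).

Lemma sample_unit n : (n <= p)%N -> sample n \in unitmx.
Proof.
move=> le_np; rewrite -unitmx_tr.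
have -> : (sample n)^T = Vandermonde n (\row_(t < n) t%:R).
  by apply/matrixP=> i t; rewrite !mxE /= expr1n mulr1.
rewrite unitmxE unitfE det_Vandermonde; apply/prodf_neq0 => i _.
apply/prodf_neq0 => j lt_ij; rewrite !mxE subr_eq0; have := (ltn_ord i, ltn_ord j).
by case=> lt_in lt_jn; rewrite nat_inj_pchar; lia.
Qed.

Lemma sample_inj n m (A B : 'M[k]_(n, m)) : (n <= p)%N ->
  (forall t, (t < n)%N -> veronese n (pt t%:R 1) *m A = veronese n (pt t%:R 1) *m B) ->
  A = B.
Proof.
move=> le_np eqAB; apply: (can_inj (mulKmx (sample_unit le_np))).
by apply/row_matrixP=> t; rewrite !row_mul rowK eqAB.
Qed.

(** Writing both identity matrices as sums of columns times evaluation rows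
    expresses the identity of the tensor product by pairs of evaluations. *)
Lemma tprod_sample_inj a b m (A B : 'M[k]_(a * b, m)) : (a <= p)%N -> (b <= p)%N ->
  (forall v w, tprod (veronese a v) (veronese b w) *m A =
               tprod (veronese a v) (veronese b w) *m B) -> A = B.
Proof.
move=> le_ap le_bp eqAB; rewrite -[A]mul1mx -[B]mul1mx -tprod1.
have E n (le_np : (n <= p)%N) : 1%:M = \sum_t col t (invmx (sample n)) *m row t (sample n).
  by rewrite -mulmx_sum_col_row mulVmx ?sample_unit.
rewrite (E _ le_ap) (E _ le_bp) -[tprod _ _]/(tprodr _ _) linear_sum !mulmx_suml.
apply: eq_bigr => s _ /=; rewrite /tprodr linear_sum !mulmx_suml; apply: eq_bigr => t _ /=.
by rewrite tprodE -!mulmxA !rowK eqAB.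
Qed.

End Veronese.

(** * Binomial identities *)

Section Binomials.

Lemma bin_mul_sub x y q : (q <= x)%N ->
  ('C(x + y, x) * 'C(x, q) = 'C(x + y, q) * 'C(x - q + y, y))%N.
Proof.
move=> le_qx; have le_qxy : (q <= x + y)%N by lia.
have := bin_fact (leq_addr y x); have := bin_fact le_qx.
have := bin_fact le_qxy; have := bin_fact (leq_addl (x - q) y).
rewrite addKn addnK (_ : x + y - q = x - q + y)%N; last by lia.
move=> E1 E2 E3 E4.
have pos : (0 < q`! * (x - q)`! * y`!)%N by rewrite !muln_gt0 !fact_gt0.
apply/eqP; rewrite -(eqn_pmul2r pos); apply/eqP; move: E1 E2 E3 E4 {pos}.
move: (q`!) ((x - q)`!) (y`!) (x`!) ((x + y)`!) ((x - q + y)`!) => a b c d e f.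
move: 'C(_, _) 'C(_, _) 'C(_, _) 'C(_, _) => C1 C2 C3 C4 E1 E2 E3 E4.
have -> : (C1 * C2 * (a * b * c) = C1 * ((C2 * (a * b)) * c))%N by ring.
have -> : (C3 * C4 * (a * b * c) = C3 * (a * (C4 * (c * b))))%N by ring.
by rewrite E1 E2 E3.
Qed.

(** Both sides satisfy Pascal's recurrence in (x, y): the value at (x+1, y+1) is
    the sum of the values at (x, y+1) and (x+1, y). *)
Lemma sum_bin_mul_bin x y z :
  (\sum_(q < x.+1) 'C(x - q + y, y) * 'C(q + z, z) = 'C((x + y + z).+1, x))%N.
Proof.
elim: x y => [|x IHx] y.
  by rewrite big_ord1 /= bin0 !add0n !binn.
elim: y => [|y IHy].
  rewrite big_ord_recr /= subnn.
  have := IHx 0%N; rewrite addn0 => IH0.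
  rewrite (eq_bigr (fun q : 'I_x.+1 => 'C(x - q + 0, 0) * 'C(q + z, z))%N); last first.
    by move=> q _; rewrite !bin0.
  rewrite IH0 bin0 mul1n !addn0 binS addnC addSn.
  by rewrite -[in RHS](bin_sub (_ : (x.+1 <= (x + z).+1)%N)) ?ltnS ?leq_addr // subSS addKn.
rewrite big_ord_recr /= subnn add0n binn mul1n.
rewrite (eq_bigr (fun q : 'I_x.+1 => 'C(x - q + y.+1, y.+1) * 'C(q + z, z) +
   'C(x.+1 - q + y, y) * 'C(q + z, z))%N); last first.
  move=> q _; rewrite -mulnDl; congr (_ * _)%N.
  have le_qx : (q <= x)%N by rewrite -ltnS.
  by rewrite subSn // !addnS !addSn binS.
rewrite big_split /= IHx -addnA.
move: IHy; rewrite big_ord_recr /= subnn add0n binn mul1n => ->.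
rewrite addnC.
by rewrite !addSn !addnS !addSn [RHS]binS addnC.
Qed.

End Binomials.

Section Char.
Variables (p : nat) (k : fieldType).
Hypothesis charkp : p \in [pchar k].

Lemma bin_neq0 n m : (n < p)%N -> (m <= n)%N -> ('C(n, m)%:R != 0 :> k).
Proof.
move=> lt_np le_mn; have p_pr := pcharf_prime charkp.
rewrite -(dvdn_pcharf charkp); apply/negP => dv.
have : (p %| n`!)%N by rewrite -(bin_fact le_mn) dvdn_mulr.
elim: {m le_mn dv} n lt_np => [|n IH] lt_np.
  by rewrite fact0 dvdn1 => /eqP p1; rewrite p1 in p_pr.
rewrite factS Euclid_dvdM // => /orP[dv|]; last by apply: IH; lia.
by rewrite gtnNdvd in dv.
Qed.

End Char.

(** * The invariant form and the endomorphisms of V_n *)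

Section Form.
Variables (p : nat) (k : fieldType).
Hypothesis charkp : p \in [pchar k].

(** The bilinear form whose value at the evaluation rows of v and w is the power
    [wedge v w ^+ n.-1] ([veronese_wedge_form]); its coefficients come from the
    binomial expansion of that power. *)
Definition wedge_form n : 'M[k]_n :=
  \matrix_(i, j) (if j == rev_ord i then (-1) ^+ j * 'C(n.-1, i)%:R else 0).

Definition wedge_form_inv n : 'M[k]_n :=
  \matrix_(i, j) (if j == rev_ord i then (-1) ^+ i / 'C(n.-1, j)%:R else 0).

Lemma wedge_formK n : (n <= p)%N -> wedge_form n *m wedge_form_inv n = 1%:M.
Proof.
move=> le_np; apply/matrixP=> i j; rewrite !mxE (bigD1 (rev_ord i)) //= big1 ?addr0.
  rewrite !mxE eqxx rev_ordK [in RHS]eq_sym; case: eqP => [->|_]; last by rewrite mulr0.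
  have lt_in := ltn_ord i.
  rewrite mulrACA -expr2 sqrr_sign mul1r mulfV //=.
  by apply: (bin_neq0 charkp); lia.
by move=> r ne_ri; rewrite !mxE (negPf ne_ri) mul0r.
Qed.

Lemma veronese_wedge_form n v w : (0 < n)%N ->
  (veronese n v *m wedge_form n *m (veronese n w)^T) 0 0 = wedge v w ^+ n.-1.
Proof.
case: n => // n _; rewrite /wedge exprBn mxE /=; apply: eq_bigr => j _.
have le_jn : (j <= n)%N by rewrite -ltnS.
rewrite mxE (bigD1 (rev_ord j)) //= big1 ?addr0 => [|i ne_ij]; last first.
  rewrite !mxE ifN ?mulr0 //; apply: contraNneq ne_ij => ->.
  by rewrite rev_ordK.
rewrite !mxE rev_ordK eqxx /= subSS bin_sub // subKn //.
by rewrite !exprMn -mulr_natr; ring.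
Qed.

Lemma bilinear_inj a b (A B : 'M[k]_(a, b)) : (a <= p)%N -> (b <= p)%N ->
  (forall v w, (veronese a v *m A *m (veronese b w)^T) 0 0 =
               (veronese a v *m B *m (veronese b w)^T) 0 0) -> A = B.
Proof.
move=> le_ap le_bp eqAB; apply: (sample_inj charkp le_ap) => s _; apply: trmx_inj.
apply: (sample_inj charkp le_bp) => t _; apply: trmx_inj.
by rewrite !trmx_mul !trmxK [LHS]mx11_scalar [RHS]mx11_scalar eqAB.
Qed.

Lemma trilinear_inj a b c (A B : 'M[k]_(a * b, c)) :
  (a <= p)%N -> (b <= p)%N -> (c <= p)%N ->
  (forall u v w,
     (tprod (veronese a u) (veronese b v) *m A *m (veronese c w)^T) 0 0 =
     (tprod (veronese a u) (veronese b v) *m B *m (veronese c w)^T) 0 0) -> A = B.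
Proof.
move=> le_ap le_bp le_cp eqAB; apply: (tprod_sample_inj charkp le_ap le_bp) => u v.
apply: trmx_inj; apply: (sample_inj charkp le_cp) => t _; apply: trmx_inj.
rewrite !trmx_mul !trmxK [LHS](@mx11_scalar _ (_ : 'M_1)) [RHS](@mx11_scalar _ (_ : 'M_1)).
by rewrite eqAB.
Qed.

(** Elements of SL_2 preserve the determinant of two vectors, hence its powers. *)
Lemma wedge_form_invariant n g : (n <= p)%N -> g \in SL2 p ->
  V_mx k n g *m wedge_form n *m (V_mx k n g)^T = wedge_form n.
Proof.
move=> le_np Gg; case: (posnP n) => [->|n_gt0]; first by apply/matrixP=> -[].
apply: bilinear_inj => // v w.
have -> : veronese n v *m (V_mx k n g *m wedge_form n *m (V_mx k n g)^T) *m (veronese n w)^T =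
  veronese n v *m V_mx k n g *m wedge_form n *m (veronese n w *m V_mx k n g)^T.
  by rewrite trmx_mul !mulmxA.
by rewrite !veronese_act !veronese_wedge_form // wedge_mul (det_SL2_map charkp Gg) mulr1.
Qed.

(** Composing f with the invariant form gives an invariant function B of two
    points.  Lower unipotent matrices fix (1, 0) and translate the points (t, 1),
    so B((1, 0), (t, 1)) does not depend on t; neither does the value of the form
    itself.  Hence f scales the evaluation row at (1, 0), and it scales those at
    all (t, 1) by the same factor, because SL_2 carries (1, 0) to each of them. *)
Lemma scalar_endomorphism n (f : 'M[k]_n) : (n <= p)%N ->
  (forall g, g \in SL2 p -> V_mx k n g *m f = f *m V_mx k n g) ->
  exists c, f = c%:M.
Proof.
move=> le_np comm_f; case: (posnP n) => [n0|n_gt0].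
  by exists 0; apply/matrixP=> -[i lt_i]; exfalso; rewrite n0 in lt_i.
pose B (v w : 'rV[k]_2) := (veronese n v *m f *m wedge_form n *m (veronese n w)^T) 0 0.
have inv_B v w g : g \in SL2 p ->
    B (v *m map_mx (@Fp_in p k) (GLval g)) (w *m map_mx (@Fp_in p k) (GLval g)) = B v w.
  move=> Gg; rewrite /B -!veronese_act trmx_mul -(mulmxA _ _ f) comm_f //.
  by rewrite !mulmxA -(mulmxA _ _ (wedge_form n)) -(mulmxA _ _ (V_mx k n g)^T) wedge_form_invariant.
have B_const t : B (pt 1 0) (pt t%:R 1) = B (pt 1 0) (pt 0 1).
  (* the matrix with rows (1, 0) and (t, 1) *)
  have [|g Gg actg] := @SL2_pt_lift p k 1 0 t%:R 1; first by ring.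
  rewrite -[RHS](inv_B _ _ g Gg) !actg !ptE !(Fp_in_nat charkp 1) (Fp_in_nat charkp 0).
  rewrite (Fp_in_nat charkp).
  by rewrite !(mulr1, mulr0, mul1r, mul0r, addr0, add0r).
have f_pt10 : veronese n (pt 1 0) *m f = B (pt 1 0) (pt 0 1) *: veronese n (pt 1 0).
  have wedge_form_unit : wedge_form n \in unitmx by have [] := mulmx1_unit (wedge_formK le_np).
  apply: (can_inj (mulmxK wedge_form_unit)).
  apply: trmx_inj; apply: (sample_inj charkp le_np) => t _; apply: trmx_inj.
  rewrite !trmx_mul !trmxK [LHS]mx11_scalar [RHS]mx11_scalar -!scalemxAl.
  rewrite -/(B _ _) B_const mxE veronese_wedge_form // /wedge !ptE mul0r subr0 mul1r.
  by rewrite expr1n mulr1.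
exists (B (pt 1 0) (pt 0 1)); apply: (sample_inj charkp le_np) => t _.
(* the matrix with rows (t, 1) and (-1, 0) *)
have [|g Gg actg] := @SL2_pt_lift p k t%:R 1 (- 1) 0; first by ring.
have -> : pt t%:R 1 = pt 1 0 *m map_mx (@Fp_in p k) (GLval g).
  rewrite actg !ptE (Fp_inN charkp) (Fp_in_nat charkp 1) (Fp_in_nat charkp 0).
  by rewrite (Fp_in_nat charkp) !(mulr1, mulr0, mul1r, mul0r, addr0, add0r).
by rewrite -veronese_act -mulmxA comm_f // mulmxA f_pt10 -scalemxAl scalar_mxC mul_scalar_mx.
Qed.

End Form.

(** * The invariant tensor of three representations *)

Section Tensor.
Variable k : fieldType.

(** The coordinate column of the monomial with exponents a and n - a. *)
Definition evec n a : 'cV[k]_n.+1 := delta_mx (inord a) 0.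

Lemma veronese_evec n v a : (a <= n)%N ->
  veronese n.+1 v *m evec n a = (v 0 0 ^+ a * v 0 1 ^+ (n - a))%:M.
Proof.
move=> le_an; rewrite [LHS]mx11_scalar; congr _%:M.
by rewrite -colE !mxE inordK.
Qed.

Lemma veronese2_evec a b u v i j : (i <= a)%N -> (j <= b)%N ->
  tprod (veronese a.+1 u) (veronese b.+1 v) *m tprod (evec a i) (evec b j) =
  ((u 0 0 ^+ i * u 0 1 ^+ (a - i)) * (v 0 0 ^+ j * v 0 1 ^+ (b - j)))%:M.
Proof. by move=> le_ia le_jb; rewrite -tprodE !veronese_evec //; apply: tprod_scalar. Qed.

(** The coefficients of [wedge u v ^+ x * wedge u w ^+ y * wedge v w ^+ z], each
    power being expanded by the binomial formula ([cg_tensorE]). *)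
Definition cg_tensor x y z : 'M[k]_((x + y).+1 * (x + z).+1, (y + z).+1) :=
  \sum_(a < x.+1) \sum_(b < y.+1) \sum_(c < z.+1)
    ((-1) ^+ a * 'C(x, a)%:R * ((-1) ^+ b * 'C(y, b)%:R) * ((-1) ^+ c * 'C(z, c)%:R)) *:
    (tprod (evec (x + y) (x - a + (y - b))) (evec (x + z) (a + (z - c))) *m
       (evec (y + z) (b + c))^T).

Lemma wedge_exp u v x : wedge u v ^+ x =
  \sum_(a < x.+1) (-1) ^+ a * 'C(x, a)%:R *
    ((u 0 0 ^+ (x - a) * u 0 1 ^+ a) * (v 0 0 ^+ a * v 0 1 ^+ (x - a))) :> k.
Proof.
rewrite /wedge exprBn; apply: eq_bigr => a _.
by rewrite !exprMn -mulr_natr; ring.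
Qed.

Lemma cg_tensorE x y z u v w :
  (tprod (veronese (x + y).+1 u) (veronese (x + z).+1 v) *m cg_tensor x y z *m
     (veronese (y + z).+1 w)^T) 0 0 =
  wedge u v ^+ x * wedge u w ^+ y * wedge v w ^+ z.
Proof.
rewrite /cg_tensor mulmx_sumr mulmx_suml summxE !wedge_exp -mulrA mulr_suml.
apply: eq_bigr => a _; rewrite mulmx_sumr mulmx_suml summxE mulr_suml mulr_sumr.
apply: eq_bigr => b _; rewrite mulmx_sumr mulmx_suml summxE !mulr_sumr.
apply: eq_bigr => c _; rewrite -scalemxAr -scalemxAl mxE mulmxA.
have [le_a le_b le_c] : [/\ a <= x, b <= y & c <= z]%N by split; rewrite -ltnS.
rewrite veronese2_evec; [|lia|lia].
rewrite mul_scalar_mx -scalemxAl -trmx_mul veronese_evec; last by lia.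
rewrite tr_scalar_mx !mxE mulr1n.
have -> : (x + y - (x - a + (y - b)) = a + b)%N by lia.
have -> : (x + z - (a + (z - c)) = (x - a) + c)%N by lia.
have -> : (y + z - (b + c) = (y - b) + (z - c))%N by lia.
by rewrite !exprD; ring.
Qed.

Variables (p : nat) (charkp : p \in [pchar k]).

(** At a coordinate vector w, two of the three determinants become coordinates
    of u and v up to sign, and only the expansion of the first power remains. *)
Lemma cg_tensor_pt01 x y z : ((x + y).+1 <= p)%N -> ((x + z).+1 <= p)%N ->
  cg_tensor x y z *m (veronese (y + z).+1 (pt 0 1))^T =
  \sum_(a < x.+1) ((-1) ^+ a * 'C(x, a)%:R) *:
    tprod (evec (x + y) (x - a + y)) (evec (x + z) (a + z)).
Proof.
move=> le1 le2; apply: (tprod_sample_inj charkp le1 le2) => u v.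
rewrite mulmxA [LHS](@mx11_scalar _ (_ : 'M_1)) cg_tensorE wedge_exp !mulr_suml.
rewrite mulmx_sumr raddf_sum; apply: eq_bigr => a _.
have le_a : (a <= x)%N by rewrite -ltnS.
rewrite -scalemxAr veronese2_evec; [|lia|lia].
rewrite scale_scalar_mx; congr _%:M.
have -> : (x + y - (x - a + y) = a)%N by lia.
have -> : (x + z - (a + z) = (x - a))%N by lia.
by rewrite /wedge !ptE !mulr0 !subr0 !mulr1 !exprD; ring.
Qed.

Lemma cg_tensor_pt10 x y z : ((x + y).+1 <= p)%N -> ((x + z).+1 <= p)%N ->
  cg_tensor x y z *m (veronese (y + z).+1 (pt 1 0))^T =
  (-1) ^+ (y + z) *: \sum_(a < x.+1) ((-1) ^+ a * 'C(x, a)%:R) *: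
    tprod (evec (x + y) (x - a)) (evec (x + z) a).
Proof.
move=> le1 le2; apply: (tprod_sample_inj charkp le1 le2) => u v.
rewrite mulmxA [LHS](@mx11_scalar _ (_ : 'M_1)) cg_tensorE wedge_exp !mulr_suml.
rewrite -scalemxAr mulmx_sumr scaler_sumr raddf_sum; apply: eq_bigr => a _.
have le_a : (a <= x)%N by rewrite -ltnS.
rewrite -scalemxAr veronese2_evec; [|lia|lia].
rewrite !scale_scalar_mx; congr _%:M.
have -> : (x + y - (x - a) = a + y)%N by lia.
have -> : (x + z - a = (x - a) + z)%N by lia.
rewrite /wedge !ptE !mulr0 !sub0r !mulr1 [(- u 0 1) ^+ y]exprNn [(- v 0 1) ^+ z]exprNn !exprD; ring.
Qed.

End Tensor.

(** * Homomorphisms from the invariant tensor *)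

Section Theta.
Variables (p : nat) (k : fieldType).
Hypothesis charkp : p \in [pchar k].

Lemma cg_tensor_invariant x y z g : ((x + y).+1 <= p)%N -> ((x + z).+1 <= p)%N ->
    ((y + z).+1 <= p)%N -> g \in SL2 p ->
  tprod (V_mx k (x + y).+1 g) (V_mx k (x + z).+1 g) *m cg_tensor k x y z *m
    (V_mx k (y + z).+1 g)^T = cg_tensor k x y z.
Proof.
move=> le1 le2 le3 Gg; apply: (trilinear_inj charkp) => // u v w.
rewrite !mulmxA -tprodE -mulmxA -trmx_mul !veronese_act !cg_tensorE.
by rewrite !wedge_mul (det_SL2_map charkp Gg) !mulr1.
Qed.

(** Invariance of J says that its inverse K intertwines the inverse transpose of S
    with S, so K converts the transposed action on the second index of T into the
    action itself. *)
Lemma invariant_dual n m (R : 'M[k]_n) (S : 'M[k]_m) (T : 'M[k]_(n, m)) (J K : 'M[k]_m) :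
  R *m T *m S^T = T -> S *m J *m S^T = J -> J *m K = 1%:M -> S \in unitmx ->
  R *m (T *m K) = T *m K *m S.
Proof.
move=> invT invJ JK S_unit; have KJ := mulmx1C JK.
have KS : S^T *m K *m S = K.
  have JSKS : J *m (S^T *m K *m S) = 1%:M.
    have -> : J *m (S^T *m K *m S) = invmx S *m (S *m J *m S^T) *m K *m S.
      by rewrite !mulmxA mulVmx // mul1mx.
    by rewrite invJ -(mulmxA (invmx S)) JK mulmx1 mulVmx.
  by rewrite -[LHS]mul1mx -KJ -(mulmxA K J) JSKS mulmx1.
by rewrite -{2}invT -!mulmxA [S^T *m _]mulmxA KS.
Qed.

Definition tensor_form_inv a b : 'M[k]_(a * b) := tprod (wedge_form_inv k a) (wedge_form_inv k b).

Lemma wedge_form_inv_evec a i j : (i <= a)%N -> (j <= a)%N ->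
  ((evec k a i)^T *m wedge_form_inv k a.+1 *m evec k a j) 0 0 =
  if (i + j == a)%N then (-1) ^+ i / 'C(a, j)%:R else 0.
Proof.
move=> le_i le_j; rewrite -colE mxE /evec trmx_delta -rowE !mxE -val_eqE /= !inordK //.
by rewrite subSS; case: eqP; case: eqP => //; lia.
Qed.

Lemma tensor_form_inv_evec a b i j i' j' :
  ((tprod (evec k a i) (evec k b j) : 'cV_(a.+1 * b.+1))^T *m tensor_form_inv a.+1 b.+1 *m
    (tprod (evec k a i') (evec k b j') : 'cV_(a.+1 * b.+1))) 0 0 =
  ((evec k a i)^T *m wedge_form_inv k a.+1 *m evec k a i') 0 0 *
  ((evec k b j)^T *m wedge_form_inv k b.+1 *m evec k b j') 0 0.
Proof.
rewrite -tprod11 !tprodE -(trmx_tprod (evec k a i)); reflexivity.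
Qed.

(** Up to sign, the value at the points (1, 0) and (0, 1) of the bilinear form
    obtained by pulling the inverse form of the tensor product back along
    [cg_tensor]. *)
Definition theta x y z : k :=
  \sum_(a < x.+1) ('C(x, a)%:R * 'C(x, x - a)%:R) / ('C(x + y, x - a + y)%:R * 'C(x + z, a + z)%:R).

Lemma thetaE x y z : ((x + y).+1 <= p)%N -> ((x + z).+1 <= p)%N ->
  (veronese (y + z).+1 (pt 1 0) *m ((cg_tensor k x y z)^T *m
     tensor_form_inv (x + y).+1 (x + z).+1 *m cg_tensor k x y z) *m
     (veronese (y + z).+1 (pt 0 1))^T) 0 0 =
  (-1) ^+ (y + z) * theta x y z.
Proof.
move=> le1 le2; set T := cg_tensor k x y z; set K := tensor_form_inv _ _.
have -> u v : u *m (T^T *m K *m T) *m v^T = (T *m u^T)^T *m K *m (T *m v^T).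
  by rewrite trmx_mul trmxK !mulmxA.
rewrite (cg_tensor_pt10 charkp) // (cg_tensor_pt01 charkp) // linearZ -!scalemxAl mxE.
congr (_ * _).
rewrite /= [(\sum_(_ < _) _)^T]raddf_sum /= !mulmx_suml summxE /theta.
(* the inverse forms pair complementary exponents, hence match the term a of one
   factor with the term x - a of the other *)
rewrite (reindex_inj rev_ord_inj); apply: eq_bigr => a _ /=.
have le_a : (a <= x)%N by rewrite -ltnS.
have trZ m n c (A : 'M[k]_(m, n)) : (c *: A)^T = c *: A^T by rewrite linearZ.
rewrite subSS subKn // trZ -!scalemxAl mxE mulmx_sumr summxE.
rewrite (bigD1 a) //= big1 => [|b ne_ba]; last first.
  have le_b : (b <= x)%N by rewrite -ltnS.
  rewrite -scalemxAr mxE tensor_form_inv_evec !wedge_form_inv_evec; [|lia..].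
  rewrite ifN ?mul0r ?mulr0 //.
  by apply: contra ne_ba; rewrite -val_eqE /=; lia.
rewrite addr0 -scalemxAr mxE tensor_form_inv_evec !wedge_form_inv_evec; [|lia..].
rewrite !ifT; [|lia..].
rewrite invfM; move: (_%:R) (_%:R) (_%:R^-1) (_%:R^-1) => c1 c2 c3 c4.
transitivity (((-1) ^+ (x - a) * (-1) ^+ (x - a)) * ((-1) ^+ a * (-1) ^+ a) *
  (c2 * c1 * (c3 * c4))); first by ring.
rewrite -!expr2 !sqrr_sign !mul1r; ring.
Qed.

(** Multiplying by the two nonzero constants C(x+y, x) and C(x+z, x) turns the
    quotients of binomials into the convolution [sum_bin_mul_bin], whose value
    C(x+y+z+1, x) is prime to p. *)
Lemma theta_neq0 x y z : (x + y + z + 1 < p)%N -> theta x y z != 0.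
Proof.
move=> lt_p.
have E : theta x y z * ('C(x + y, x)%:R * 'C(x + z, x)%:R) = 'C((x + y + z).+1, x)%:R.
  rewrite -sum_bin_mul_bin mulr_suml raddf_sum; apply: eq_bigr => a _ /=.
  have le_a : (a <= x)%N by rewrite -ltnS.
  have := bin_mul_sub y le_a; have := bin_mul_sub z (leq_subr a x).
  rewrite subKn // => /(congr1 (fun i : nat => i%:R : k)) /= E1.
  move/(congr1 (fun i : nat => i%:R : k)) => /= E2; move: E1 E2; rewrite !natrM => E1 E2.
  have [n1 n2] : 'C(x + y, a)%:R != 0 :> k /\ 'C(x + z, x - a)%:R != 0 :> k.
    by split; apply: (bin_neq0 charkp); lia.
  have -> : 'C(x + y, x - a + y) = 'C(x + y, a).
    by rewrite -(bin_sub (_ : (a <= x + y)%N)) ?addnBAC //; lia.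
  have -> : 'C(x + z, a + z) = 'C(x + z, x - a).
    rewrite -(bin_sub (_ : (x - a <= x + z)%N)); last by lia.
    by congr 'C(_, _); lia.
  move: E1 E2 n1 n2.
  move: ('C(x + y, a)%:R : k) ('C(x + z, x - a)%:R : k) ('C(x + y, x)%:R : k)
    ('C(x + z, x)%:R : k) => c1 c2 c3 c4 E1 E2 n1 n2.
  transitivity ((c3 * 'C(x, a)%:R) * (c4 * 'C(x, x - a)%:R) / (c1 * c2)); first by ring.
  by rewrite E1 E2; field; rewrite n1 n2.
have : theta x y z * ('C(x + y, x)%:R * 'C(x + z, x)%:R) != 0.
  by rewrite E; apply: (bin_neq0 charkp); lia.
by apply: contraNneq => ->; rewrite mul0r.
Qed.

Lemma clebsch_gordan_maps x y z (a := (x + y).+1) (b := (x + z).+1) (c := (y + z).+1)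
    (rM := prod_repr (V_repr charkp a) (V_repr charkp b)) (rV := V_repr charkp c) :
    (x + y + z + 1 < p)%N ->
  exists f h, [/\ forall g, g \in SL2 p -> rV g *m f = f *m rM g,
                 forall g, g \in SL2 p -> rM g *m h = h *m rV g & f *m h != 0].
Proof.
move=> lt_p; have [le_a le_b le_c] : [/\ a <= p, b <= p & c <= p]%N by rewrite /a /b /c; split; lia.
set T := cg_tensor k x y z.
exists (T^T *m tensor_form_inv a b), (T *m wedge_form_inv k c); split=> [g Gg|g Gg|].
- apply: (@invariant_dual _ _ _ _ _ (tprod (wedge_form k a) (wedge_form k b))).
  + have := cg_tensor_invariant le_a le_b le_c Gg => /(congr1 trmx).
    by rewrite !trmx_mul trmxK mulmxA.
  + by rewrite trmx_tprod -!tprodE !(wedge_form_invariant charkp).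
  + by rewrite -tprodE !(wedge_formK charkp) // tprod1.
  + exact: repr_mx_unit.
- apply: (@invariant_dual _ _ _ _ _ (wedge_form k c)).
  + exact: cg_tensor_invariant.
  + exact: wedge_form_invariant.
  + exact: (wedge_formK charkp).
  + exact: (repr_mx_unit rV Gg).
apply/eqP => /(congr1 (mulmx^~ (wedge_form k c))).
rewrite /= mul0mx !mulmxA -(mulmxA _ (wedge_form_inv k c)).
rewrite (mulmx1C (wedge_formK charkp le_c)) mulmx1 => T0.
have := thetaE le_a le_b; rewrite -/T T0 mulmx0 mul0mx mxE => /esym/eqP.
by rewrite mulf_eq0 signr_eq0 (negPf (theta_neq0 lt_p)).
Qed.

End Theta.

(** * Multiplicities in V_i (x) V_n *)

Section WalkMult.
Variables (p : nat) (k : fieldType).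
Hypothesis charkp : p \in [pchar k].

(** The element is -1. *)
Lemma V_mx_opp1 : exists2 g, g \in SL2 p &
  forall m, (m <= p)%N -> V_mx k m g = ((-1) ^+ m.-1)%:M.
Proof.
have [|g Gg actg] := @SL2_pt_lift p k (-1) 0 0 (-1); first by ring.
exists g => // m le_mp; apply: (sample_inj charkp le_mp) => t _.
rewrite veronese_act actg !ptE Fp_inN // (Fp_in_nat charkp 0) (Fp_in_nat charkp 1).
rewrite scalar_mxC mul_scalar_mx; apply/rowP=> i; rewrite !mxE /=.
have le_im : (i <= m.-1)%N by have := ltn_ord i; lia.
rewrite -[in X in _ = X * _](subnKC le_im) exprD.
rewrite !(mulr0, mul0r, addr0, add0r, mul1r) mulrN1 (exprNn t%:R).
by rewrite expr1n mulr1; ring.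
Qed.

(** Compare the scalars by which -1 acts; since p > 2, they determine parities. *)
Lemma walk_mult_odd n (i j : 'I_p.-1) : (2 < p)%N -> (0 < n)%N -> (n <= p)%N ->
  (0 < walk_mult charkp n i j)%N -> odd j = odd i (+) ~~ odd n.
Proof.
move=> p_gt2 n_gt0 le_np; have [g Gg actg] := V_mx_opp1.
have [le_i le_j] : (i.+1 <= p)%N /\ (j.+1 <= p)%N.
  by have := (ltn_ord i, ltn_ord j); case; lia.
move/(summand_mult_scalar (c := (-1) ^+ (i + n.-1)) (d := (-1) ^+ j) Gg).
rewrite /= => sgn.
have: (-1) ^+ (i + n.-1) = (-1) ^+ j :> k.
  apply: sgn => //; last by rewrite (actg _ le_j).
  rewrite (actg _ le_i) (actg _ le_np) exprD.
  exact: tprod_scalar.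
rewrite -signr_odd -[RHS]signr_odd oddD.
have -> : odd n.-1 = ~~ odd n by case: (n) n_gt0 => //= m _; rewrite negbK.
have sgn_neq : -1 != 1 :> k.
  rewrite -subr_eq0 -opprD oppr_eq0 -(natrD _ 1 1) -(dvdn_pcharf charkp).
  by rewrite gtnNdvd.
case: (_ (+) _); case: (odd j) => //=; rewrite expr0 expr1 => E; move: sgn_neq.
  by rewrite E eqxx.
by rewrite -E eqxx.
Qed.

(** That the degrees i, n.-1, j are the pairwise sums of x, y, z is the triangle
    condition of the Clebsch-Gordan rule; the bound on x + y + z is its truncation
    in characteristic p. *)
Lemma walk_mult_gt0 n (i j : 'I_p.-1) x y z : i = (x + y)%N :> nat ->
    n = (x + z).+1 -> j = (y + z)%N :> nat -> (x + y + z + 1 < p)%N ->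
  (0 < walk_mult charkp n i j)%N.
Proof.
rewrite /walk_mult => -> -> -> lt_p.
have [f [h [Cf Ch nz]]] := clebsch_gordan_maps charkp lt_p.
apply: (@summand_mult_gt0 _ _ _
  (Representation (prod_repr (V_repr charkp (x + y).+1) (V_repr charkp (x + z).+1)))
  (Representation (V_repr charkp (y + z).+1)) f h) => //= u Cu.
by apply: (scalar_endomorphism charkp) => //; lia.
Qed.

End WalkMult.

(** * Reachability and periods for nonnegative matrices *)

Section NonnegativeMatrix.
Variables (R : realType) (m : nat) (Q : 'M[R]_m).
Hypothesis Q_ge0 : forall i j, 0 <= Q i j.

Definition reaches i j := exists t : nat, 0 < (Q ^+ t) i j.

Lemma exp_ge0 t i j : 0 <= (Q ^+ t) i j.
Proof.
elim: t i j => [|t IH] i j; first by rewrite expr0 mxE ler0n.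
by rewrite exprS mxE sumr_ge0 // => l _; rewrite mulr_ge0.
Qed.

Lemma expD_gt0 s t i j l : 0 < (Q ^+ s) i j -> 0 < (Q ^+ t) j l -> 0 < (Q ^+ (s + t)) i l.
Proof.
move=> ij jl; rewrite exprD mxE (bigD1 j) //= ltr_pwDl ?mulr_gt0 //.
by rewrite sumr_ge0 // => r _; rewrite mulr_ge0 ?exp_ge0.
Qed.

Lemma reaches_refl i : reaches i i.
Proof. by exists 0%N; rewrite expr0 mxE eqxx ltr01. Qed.

Lemma reaches_edge i j : 0 < Q i j -> reaches i j.
Proof. by exists 1%N; rewrite expr1. Qed.

Lemma reaches_trans i j l : reaches i j -> reaches j l -> reaches i l.
Proof. by move=> [s ij] [t jl]; exists (s + t)%N; apply: expD_gt0 ij jl. Qed.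

Lemma exp_gt0_parity (c : 'I_m -> bool) (d : bool) :
    (forall i j, 0 < Q i j -> c j = c i (+) d) ->
  forall t i j, 0 < (Q ^+ t) i j -> c j = c i (+) (odd t && d).
Proof.
move=> cQ; elim=> [|t IH] i j.
  rewrite expr0 mxE; case: eqP => [->|_]; last by rewrite ltxx.
  by rewrite addbF.
rewrite exprS mxE => /lt0r_neq0 /eqP sum_neq0.
have [l] : exists l, Q i l * (Q ^+ t) l j != 0.
  apply: contrapT => /forallNP no; apply: sum_neq0; rewrite big1 // => l _.
  by have /negP := no l; rewrite negbK => /eqP.
rewrite mulf_eq0 negb_or => /andP[Qil Qlj].
rewrite (IH l j) ?lt_def ?Qlj ?exp_ge0 // (cQ i l) ?lt_def ?Qil ?Q_ge0 //=.
by case: (c i); case: (d); case: (odd t).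
Qed.

Lemma reaches_parity_class (l : 'I_m -> nat) : injective l ->
    (forall a b, l b = (l a).+2 -> reaches a b /\ reaches b a) ->
    (forall a b, (l a < l b)%N -> odd (l a) = odd (l b) -> exists a', l a' = (l a).+2) ->
  forall a b, odd (l a) = odd (l b) -> reaches a b.
Proof.
move=> l_inj step next.
suff both a b : (l a <= l b)%N -> odd (l a) = odd (l b) -> reaches a b /\ reaches b a.
  move=> a b eq_ab; case: (leqP (l a) (l b)) => [le_ab|/ltnW le_ba].
    by case: (both a b).
  by case: (both b a).
have [d le_d] := ubnP (l b - l a); elim: d => // d IH in a le_d *.
rewrite leq_eqVlt => /predU1P[/l_inj -> _|lt_ab eq_ab]; first by split; apply: reaches_refl.
have [a' def_a'] := next a b lt_ab eq_ab; have [aa' a'a] := step a a' def_a'.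
have [|||a'b ba'] := IH a'; rewrite ?def_a' /= ?negbK //; try lia.
by split; [apply: reaches_trans a'b | apply: reaches_trans a'a].
Qed.

(** Going to l and back takes time s + t, and s + t + 1 with one turn of the loop:
    two consecutive return times. *)
Lemma period1_of_loop i l : reaches i l -> reaches l i -> 0 < Q l l -> state_period Q i 1.
Proof.
move=> [s il] [t li] ll e; split=> [|ret]; first by rewrite dvdn1 => /eqP-> u _; apply: dvd1n.
have il1 : 0 < (Q ^+ (s + 1)) i l by apply: expD_gt0 il _; rewrite expr1.
have st : (e %| s + t)%N.
  case: (posnP (s + t)) => [->|pos]; first exact: dvdn0.
  by apply: ret; split=> //; apply: expD_gt0 il li.
have : (e %| s + 1 + t)%N by apply: ret; split; [lia | apply: expD_gt0 il1 li].
by rewrite addnAC dvdn_addr.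
Qed.

End NonnegativeMatrix.

(** * The walk *)

Section Walk.
Variables (p : nat) (p_gt2 : (2 < p)%N) (k : fieldType).
Variables (charkp : p \in [pchar k]) (n : nat) (n_ge2 : (2 <= n)%N) (n_le : (n <= p - 2)%N).
Variables (R : realType) (w : 'I_p.-1 -> R) (w_gt0 : forall i, 0 < w i).

Let Q := walk_mx charkp n w.

Lemma walk_mult_sum_ge0 i (P : pred 'I_p.-1) :
  0 <= \sum_(l | P l) w l * (walk_mult charkp n i l)%:R.
Proof. by rewrite sumr_ge0 // => l _; rewrite mulr_ge0 ?ler0n // ltW. Qed.

Lemma walk_ge0 i j : 0 <= Q i j.
Proof. by rewrite mxE divr_ge0 ?walk_mult_sum_ge0 // mulr_ge0 ?ler0n // ltW. Qed.

Lemma walk_gt0 i j : (0 < Q i j) = (0 < walk_mult charkp n i j)%N.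
Proof.
rewrite mxE; case: posnP => [->|pos]; first by rewrite mulr0 mul0r ltxx.
have wpos : 0 < w j * (walk_mult charkp n i j)%:R by rewrite mulr_gt0 ?ltr0n.
by rewrite divr_gt0 // (bigD1 j) //= ltr_pwDl ?walk_mult_sum_ge0.
Qed.

Lemma walk_odd i j : 0 < Q i j -> odd j = odd i (+) ~~ odd n.
Proof. by rewrite walk_gt0; apply: walk_mult_odd => //; lia. Qed.

(** Exchanging x and z reverses the step. *)
Lemma walk_edge (i j : 'I_p.-1) x y z : i = (x + y)%N :> nat ->
    n = (x + z).+1 -> j = (y + z)%N :> nat -> (x + y + z + 1 < p)%N ->
  0 < Q i j /\ 0 < Q j i.
Proof.
move=> def_i def_n def_j lt_p; rewrite !walk_gt0; split.
  exact: (walk_mult_gt0 charkp def_i def_n def_j).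
by apply: (@walk_mult_gt0 _ _ _ _ _ _ z y x); lia.
Qed.

Lemma walk_has_edge i : exists j, 0 < Q i j /\ 0 < Q j i.
Proof.
(* the least x for which x + y + z + 1 < p; then j is the largest neighbour *)
have lt_i := ltn_ord i; pose x := ((i + n).+1 - p)%N.
have lt_j : ((i - x) + (n.-1 - x) < p.-1)%N by rewrite /x; lia.
by exists (Ordinal lt_j); apply: (@walk_edge _ _ x (i - x) (n.-1 - x)) => //=; rewrite /x; lia.
Qed.

(** A common neighbour comes from (x, y, z) at i and (x+1, y+1, z-1) at i+2; the
    second triple has the larger sum, so x is chosen to satisfy its bound. *)
Lemma walk_two_steps (i j : 'I_p.-1) : j = i.+2 :> nat ->
  exists l, [/\ 0 < Q i l, 0 < Q l i, 0 < Q l j & 0 < Q j l].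
Proof.
move=> def_j; have lt_j := ltn_ord j; pose x := ((i + n).+2 - p)%N.
have lt_l : ((i - x) + (n.-1 - x) < p.-1)%N by rewrite /x; lia.
exists (Ordinal lt_l).
have [|||| il li] := @walk_edge i (Ordinal lt_l) x (i - x) (n.-1 - x); try by rewrite /= /x; lia.
have [|||| jl lj] := @walk_edge j (Ordinal lt_l) x.+1 (i - x).+1 (n.-1 - x).-1;
  try by rewrite /= /x; lia.
by split.
Qed.

Lemma walk_stochastic : stochastic Q.
Proof.
split=> [|i]; first exact: walk_ge0.
under eq_bigr do rewrite mxE; rewrite -mulr_suml mulfV //.
have [j [+ _]] := walk_has_edge i; rewrite mxE => Qij.
by apply: contraTneq Qij => ->; rewrite invr0 mulr0 ltxx.
Qed.

Lemma walk_cross0 (i j : 'I_p.-1) : odd n -> odd i != odd j -> Q i j = 0.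
Proof.
move=> odd_n ne_ij; apply/eqP; rewrite -[_ == 0]negbK; apply: contra ne_ij => nz.
by rewrite (@walk_odd i j) ?odd_n ?addbF // lt_def nz walk_ge0.
Qed.

(** Loops at x = z = (n-1)/2, with y = 0 or 1 chosen to fit the parity b. *)
Lemma walk_loop (b : bool) : odd n -> exists2 i : 'I_p.-1, odd i = b & 0 < Q i i.
Proof.
move=> odd_n; pose q := n./2; pose y := (b (+) odd q : nat).
have y_le1 : (y <= 1)%N by apply: leq_b1.
have def_n : n = (q + q).+1 by rewrite /q addnn -add1n -{1}[n]odd_double_half odd_n.
have lt_i : (q + y < p.-1)%N by lia.
exists (Ordinal lt_i) => /=; first by rewrite oddD oddb addbCA addbb addbF.
by case: (@walk_edge (Ordinal lt_i) (Ordinal lt_i) q y q) => //=; lia.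
Qed.

(** The common neighbours of two states of S again lie in S, since for n odd the
    steps preserve parity; so the subchain communicates and has a loop. *)
Lemma walk_class (b : bool) (S : {set 'I_p.-1}) : (forall i, (i \in S) = (odd i == b)) ->
  odd n -> irreducible_chain (subchain Q S) /\ aperiodic (subchain Q S).
Proof.
move=> memS odd_n; pose T := subchain Q S.
have T_ge0 a c : 0 <= T a c by rewrite mxE walk_ge0.
have odd_val (a : 'I_#|S|) : odd (enum_val a) = b by apply/eqP; rewrite -memS enum_valP.
have lift_S (i : 'I_p.-1) : odd i = b -> exists a : 'I_#|S|, enum_val a = i.
  move/eqP; rewrite -memS => Si; exists (enum_rank_in Si i); exact: enum_rankK_in.
have reachT a c : reaches T a c.
  apply: (@reaches_parity_class _ _ T T_ge0 (fun a => enum_val a : nat)).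
  - by move=> a1 a2 /val_inj /enum_val_inj.
  - move=> a1 a2 /walk_two_steps[l [il li lj jl]].
    have [r def_r] : exists r : 'I_#|S|, enum_val r = l.
      by apply: lift_S; rewrite (walk_odd il) odd_n addbF odd_val.
    by split; apply: (@reaches_trans _ _ T T_ge0 _ r); apply: reaches_edge; rewrite mxE def_r.
  - move=> a1 a2 lt12 _; have lt_p := ltn_ord (enum_val a2).
    have [ne1|eq1] := eqVneq (enum_val a2 : nat) (enum_val a1).+1.
      by have := odd_val a2; rewrite ne1 /= odd_val; case: (b).
    have lt3 : ((enum_val a1).+2 < p.-1)%N by lia.
    have [|r def_r] := @lift_S (Ordinal lt3); first by rewrite /= negbK odd_val.
    by exists r; rewrite def_r.
  - by rewrite !odd_val.
split=> [a c|a]; first exact: reachT.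
have [i odd_i Qii] := walk_loop b odd_n; have [r def_r] := lift_S i odd_i.
by apply: (@period1_of_loop _ _ T T_ge0 a r) => //; rewrite mxE def_r.
Qed.

Lemma walk_even_irreducible : ~~ odd n -> irreducible_chain Q /\ has_period Q 2.
Proof.
move=> even_n.
have same (i j : 'I_p.-1) : odd i = odd j -> reaches Q i j.
  apply: (@reaches_parity_class _ _ Q walk_ge0 (fun i => i : nat) val_inj).
    move=> a1 a2 /walk_two_steps[l [il li lj jl]].
    by split; apply: (@reaches_trans _ _ Q walk_ge0 _ l); apply: reaches_edge.
  move=> a1 a2 lt12 eq12; have lt_p := ltn_ord a2.
  have [ne1|ne1] := eqVneq (a2 : nat) a1.+1; first by move: eq12; rewrite ne1 /=; case: odd.
  have lt3 : (a1.+2 < p.-1)%N by lia.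
  by exists (Ordinal lt3).
split=> [i j|i e].
  have [eq_ij|ne_ij] := eqVneq (odd i) (odd j); first exact: same.
  have [l [il _]] := walk_has_edge i.
  apply: (reaches_trans walk_ge0 (reaches_edge il)); apply: same.
  by rewrite (walk_odd il) even_n addbT; case: (odd i) (odd j) ne_ij => [] [].
split=> [e2 t [_ ret]|ret].
  apply: (dvdn_trans e2); rewrite dvdn2.
  have := exp_gt0_parity walk_ge0 walk_odd ret; rewrite even_n andbT.
  by case: (odd i) (odd t) => [] [].
have [l [il li]] := walk_has_edge i.
by apply: ret; split=> //; apply: (@expD_gt0 _ _ Q walk_ge0 1 1 _ l); rewrite expr1.
Qed.

End Walk.

Theorem proposition5p5
  (p : nat) (p_prime : prime p) (p_gt2 : (2 < p)%N)
  (k : closedFieldType) (charkp : p \in [pchar k])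
  (n : nat) (n_ge2 : (2 <= n)%N) (n_le : (n <= p - 2)%N)
  (R : realType) (w : 'I_p.-1 -> R) (w_gt0 : forall i, 0 < w i) :
  stochastic (walk_mx charkp n w) /\
  (odd n ->
     reducible_into (walk_mx charkp n w) (even_states p) (odd_states p) /\
     (irreducible_chain (subchain (walk_mx charkp n w) (even_states p)) /\
      aperiodic (subchain (walk_mx charkp n w) (even_states p))) /\
     (irreducible_chain (subchain (walk_mx charkp n w) (odd_states p)) /\
      aperiodic (subchain (walk_mx charkp n w) (odd_states p)))) /\
  (~~ odd n ->
     irreducible_chain (walk_mx charkp n w) /\
     has_period (walk_mx charkp n w) 2).
Proof.
split; first exact: walk_stochastic.
split; last exact: walk_even_irreducible.
move=> odd_n.
have mem_even i : (i \in even_states p) = (odd i == true).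
  by rewrite inE /= negbK; case: odd.
have mem_odd i : (i \in odd_states p) = (odd i == false).
  by rewrite inE /=; case: odd.
split; last by split; [apply: walk_class mem_even _ | apply: walk_class mem_odd _].
have [lt0 lt1] : (0 < p.-1)%N /\ (1 < p.-1)%N by lia.
split.
- split; apply/set0Pn; [exists (Ordinal lt1) | exists (Ordinal lt0)].
    by rewrite mem_even.
  by rewrite mem_odd.
- split.
    rewrite disjoint_subset; apply/fintype.subsetP=> i.
    by rewrite mem_even inE /= mem_odd => /eqP->.
  by apply/setP=> i; rewrite finset.in_setU mem_even mem_odd finset.in_setT; case: odd.
- move=> i j; rewrite mem_even mem_odd => /eqP oi /eqP oj.
  by rewrite walk_cross0 // oi oj.
- move=> i j; rewrite mem_even mem_odd => /eqP oi /eqP oj.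
  by rewrite walk_cross0 // oi oj.
Qed.
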